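(* There is a universal constant $c$ such that the following holds. Let $T$ be a decision tree of depth $d$ computing a Boolean function $f:\{-1,1\}^n\to\{0,1\}$, and let $p=\Pr_x[f(x)=1]$ for uniform $x$. Then for every $\ell\le d$, $$\sum_{S\subseteq[n]:|S|=\ell}|\hat f(S)|\ \le\ \sqrt{c^{\ell}\binom{d}{\ell}}\cdot p\cdot\prod_{i=0}^{\ell-1}\sqrt{\log(4n^i/p)}.$$
   Context: Fourier coefficients: $\hat f(S)=\mathbb E_{x}[f(x)\prod_{i\in S}x_i]$ for $x$ uniform on $\{-1,1\}^n$. *)

(* Defs.v *)
From HB Require Import structures.
From mathcomp Require Import all_boot all_order all_algebra.
From mathcomp Require Import reals exp.
Set Implicit Arguments. Unset Strict Implicit. Unset Printing Implicit Defensive.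
Import Order.TTheory GRing.Theory Num.Theory.
Local Open Scope ring_scope.

(* Points of {-1,1}^n are encoded as x : {ffun 'I_n -> bool};
   the coordinate x_i in {-1,1} is [pm (x i)] (true |-> -1, false |-> 1). *)
Definition pm (R : ringType) (b : bool) : R := if b then -1 else 1.

(* Decision trees over n variables with Boolean (0/1) leaves.
   [Node i t_neg t_pos] queries x_i and goes to t_neg if x_i = -1,
   to t_pos if x_i = 1. *)
Inductive dtree (n : nat) : Type :=
| Leaf of bool
| Node of 'I_n & dtree n & dtree n.

Fixpoint dt_eval (n : nat) (t : dtree n) (x : {ffun 'I_n -> bool}) : bool :=
  match t with
  | Leaf b => b
  | Node i t0 t1 => if x i then dt_eval t0 x else dt_eval t1 x
  end.

Fixpoint dt_depth (n : nat) (t : dtree n) : nat :=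
  match t with
  | Leaf _ => 0%N
  | Node _ t0 t1 => (maxn (dt_depth t0) (dt_depth t1)).+1
  end.

Definition fval (R : ringType) (n : nat) (f : {ffun 'I_n -> bool} -> bool)
  (x : {ffun 'I_n -> bool}) : R := (f x)%:R.

Definition fourier (R : fieldType) (n : nat) (f : {ffun 'I_n -> bool} -> bool)
  (S : {set 'I_n}) : R :=
  (2 ^+ n)^-1 * \sum_(x : {ffun 'I_n -> bool})
                  fval R f x * \prod_(i in S) pm R (x i).

Definition prob1 (R : fieldType) (n : nat) (f : {ffun 'I_n -> bool} -> bool) : R :=
  (2 ^+ n)^-1 * \sum_(x : {ffun 'I_n -> bool}) fval R f x.

(* Main.v *)
Require Import Defs.
From HB Require Import structures.
From mathcomp Require Import all_boot all_order all_algebra.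
From mathcomp Require Import reals exp.
From mathcomp Require boolp.
From mathcomp Require Import ring lra.
Set Implicit Arguments. Unset Strict Implicit. Unset Printing Implicit Defensive.
Import Order.TTheory GRing.Theory Num.Theory.
Local Open Scope ring_scope.

(** Let V_t(x) be the set of variables queried in the first t steps on input x.
    Signs a_S turn the left-hand side into E[f(x) X(x)], where X is the sum of
    a_S x_S over the S of size l inside V_d(x): the other S cancel by flipping
    an unqueried variable of S.  As a process in t, X is a martingale whose
    increments are x_i Y, with x_i the fresh variable and Y the process of level
    l-1 for the signs a_(S u i).  The two-point inequality
    E|a + eps b|^(2k) <= (a^2 + 4 k b^2)^k and Minkowski's inequality in L^k give
    |X_(t+1)|_(2k)^2 <= |X_t|_(2k)^2 + 4 k |Y|_(2k)^2.  Since i depends on x,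
    |Y|_(2k) is bounded by summing the 2k'-th moments over all n choices of i,
    for some k' >= k with n <= 2^k'; this is why the moments grow with the level,
    k_i ~ log(4 n^i / p).  Pascal's rule then yields
    |X|_(2 k_0)^2 <= 16^l C(d, l) k_0 ... k_(l-1), and E[f X] <= 4 p |X|_(2 k_0)
    because 2^(k_0) >= 1 / p. *)

(** * Elementary inequalities behind the two-point moment bound *)

Lemma subr_mul_expr_ge0 (R : realFieldType) (u v : R) k : 0 <= u -> 0 <= v ->
  0 <= (u - v) * (u ^+ k - v ^+ k).
Proof.
move=> u0 v0; case/orP: (le_total u v) => uv.
  by rewrite mulr_le0 ?subr_le0 ?lerXn2r.
by rewrite mulr_ge0 ?subr_ge0 ?lerXn2r.
Qed.

(** Chebyshev's sum inequality: the sides differ by half the product in [subr_mul_expr_ge0]. *)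
Lemma half_sum_expr_le (R : realFieldType) (u v : R) k : 0 <= u -> 0 <= v ->
  (u + v) / 2 * (u ^+ k + v ^+ k) <= u ^+ k.+1 + v ^+ k.+1.
Proof.
move=> u0 v0.
have h := subr_mul_expr_ge0 k u0 v0.
rewrite !exprS; nra.
Qed.

(** The trapezoid rule overestimates the integral of the convex function (k+1) z^k between v and u.
    Multiplying by u - v makes the sign uniform, and induction avoids the integral. *)
Lemma subr_expr_mul_le (R : realFieldType) (u v : R) k : 0 <= u -> 0 <= v ->
  (u ^+ k.+1 - v ^+ k.+1) * (u - v)
  <= k.+1%:R / 2 * (u - v) ^+ 2 * (u ^+ k + v ^+ k).
Proof.
move=> u0 v0; elim: k => [|k IH].
  by rewrite !expr0 !expr1 expr2 le_eqVlt; apply/orP; left; apply/eqP; field.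
have -> : (u ^+ k.+2 - v ^+ k.+2) * (u - v)
    = (u + v) / 2 * ((u ^+ k.+1 - v ^+ k.+1) * (u - v))
      + (u - v) ^+ 2 / 2 * (u ^+ k.+1 + v ^+ k.+1).
  by rewrite !exprS; field.
have h1 : (u + v) / 2 * ((u ^+ k.+1 - v ^+ k.+1) * (u - v))
    <= (u + v) / 2 * (k.+1%:R / 2 * (u - v) ^+ 2 * (u ^+ k + v ^+ k)).
  by apply: ler_wpM2l => //; lra.
have h2 : k.+1%:R / 2 * (u - v) ^+ 2 * ((u + v) / 2 * (u ^+ k + v ^+ k))
    <= k.+1%:R / 2 * (u - v) ^+ 2 * (u ^+ k.+1 + v ^+ k.+1).
  apply: ler_wpM2l (half_sum_expr_le _ u0 v0).
  by rewrite mulr_ge0 ?sqr_ge0 ?divr_ge0.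
rewrite -(natr1 k.+1); lra.
Qed.

(** Let u, v be the squares of a + b and a - b. Then u^(k+1) + v^(k+1) is the mean of u and v,
    namely a^2 + b^2, times u^k + v^k, plus (u^k - v^k)(u - v)/2. Since (u - v)^2 = 16 a^2 b^2, the
    trapezoid bound makes the last term at most 4 k b^2 (u^k + v^k). *)
Lemma two_point_step (R : realFieldType) (a b : R) k :
  (a + b) ^+ (2 * k.+1) + (a - b) ^+ (2 * k.+1)
  <= (a ^+ 2 + (4 * k%:R + 1) * b ^+ 2)
     * ((a + b) ^+ (2 * k) + (a - b) ^+ (2 * k)).
Proof.
rewrite !exprM.
have [u0 v0] : 0 <= (a + b) ^+ 2 /\ 0 <= (a - b) ^+ 2 by rewrite !sqr_ge0.
have euv : ((a + b) ^+ 2 + (a - b) ^+ 2) / 2 = a ^+ 2 + b ^+ 2 by field.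
have duv : (a + b) ^+ 2 - (a - b) ^+ 2 = 4 * a * b by ring.
have -> : ((a + b) ^+ 2) ^+ k.+1 + ((a - b) ^+ 2) ^+ k.+1 =
    ((a + b) ^+ 2 + (a - b) ^+ 2) / 2
      * (((a + b) ^+ 2) ^+ k + ((a - b) ^+ 2) ^+ k)
    + (((a + b) ^+ 2) ^+ k - ((a - b) ^+ 2) ^+ k)
      * ((a + b) ^+ 2 - (a - b) ^+ 2) / 2.
  by rewrite ![_ ^+ k.+1]exprS; field.
case: k => [|k]; first by rewrite euv !expr0 subrr !mul0r mulr0 add0r mul1r addr0.
have h1 := @subr_expr_mul_le _ _ _ k u0 v0.
have h2 := @half_sum_expr_le _ _ _ k u0 v0.
rewrite euv in h2 *; rewrite duv in h1 *.
set u := (a + b) ^+ 2 in h1 h2 u0 *; set v := (a - b) ^+ 2 in h1 h2 v0 *.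
clearbody u v.
have uvk : 0 <= u ^+ k + v ^+ k by rewrite addr_ge0 ?exprn_ge0.
have h3 : a ^+ 2 * (u ^+ k + v ^+ k) <= u ^+ k.+1 + v ^+ k.+1.
  by apply: le_trans h2; rewrite ler_wpM2r // lerDl sqr_ge0.
have h4 : 4 * k.+1%:R * b ^+ 2 * (a ^+ 2 * (u ^+ k + v ^+ k))
    <= 4 * k.+1%:R * b ^+ 2 * (u ^+ k.+1 + v ^+ k.+1).
  by apply: ler_wpM2l h3; apply: mulr_ge0; [exact: mulr_ge0 | exact: sqr_ge0].
lra.
Qed.

Lemma two_point_moment (R : realFieldType) (a b : R) k :
  (a + b) ^+ (2 * k) + (a - b) ^+ (2 * k)
  <= 2 * (a ^+ 2 + 4 * k%:R * b ^+ 2) ^+ k.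
Proof.
have b2 : 0 <= b ^+ 2 by exact: sqr_ge0.
have a2 : 0 <= a ^+ 2 by exact: sqr_ge0.
(* The k in the factor stays fixed while the exponent m climbs to k; each step needs only 4m + 1 <=
   4k. *)
suff H m : (m <= k)%N -> (a + b) ^+ (2 * m) + (a - b) ^+ (2 * m)
    <= 2 * (a ^+ 2 + 4 * k%:R * b ^+ 2) ^+ m by exact: H.
elim: m => [|m IH] mk; first by rewrite muln0 !expr0 mulr1.
apply: le_trans (two_point_step _ _ _) _.
rewrite [_ ^+ m.+1]exprS [leRHS]mulrCA; apply: ler_pM.
- apply: addr_ge0 => //; apply: mulr_ge0 => //.
  by have := ler0n R m; lra.
- by rewrite !exprM; apply: addr_ge0; apply: exprn_ge0; apply: sqr_ge0.
- rewrite lerD2l; apply: ler_wpM2r => //.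
  have : (m.+1%:R : R) <= k%:R by rewrite ler_nat.
  by rewrite -natr1; lra.
- exact/IH/ltnW.
Qed.

(** * Expectations and moments on the cube *)

Lemma convex_expr (R : realFieldType) (s t x y : R) k :
  0 <= s -> 0 <= t -> s + t = 1 -> 0 <= x -> 0 <= y ->
  (s * x + t * y) ^+ k <= s * x ^+ k + t * y ^+ k.
Proof.
move=> s0 t0 st x0 y0; elim: k => [|k IH]; first by rewrite !expr0 !mulr1 st.
have h1 : (s * x + t * y) * (s * x + t * y) ^+ k
    <= (s * x + t * y) * (s * x ^+ k + t * y ^+ k).
  by apply: ler_wpM2l IH; rewrite addr_ge0 ?mulr_ge0.
(* With t = 1 - s, this product is exactly the slack of the induction step. *)
have h : 0 <= s * t * ((x - y) * (x ^+ k - y ^+ k)).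
  by rewrite mulr_ge0 ?subr_mul_expr_ge0 // mulr_ge0.
rewrite exprS; apply: le_trans h1 _; rewrite -subr_ge0 !exprS.
have et : t = 1 - s by lra.
by move: h; rewrite et; congr (0 <= _); ring.
Qed.

Definition Ex (R : fieldType) n (g : {ffun 'I_n -> bool} -> R) : R :=
  (2 ^+ n)^-1 * \sum_x g x.

Definition chi (R : nzRingType) n (S : {set 'I_n}) (x : {ffun 'I_n -> bool}) : R :=
  \prod_(i in S) pm R (x i).

Lemma eq_Ex (R : fieldType) n (g h : {ffun 'I_n -> bool} -> R) :
  g =1 h -> Ex g = Ex h.
Proof. by move=> gh; rewrite /Ex; congr (_ * _); apply: eq_bigr. Qed.

Lemma ExD (R : fieldType) n (g h : {ffun 'I_n -> bool} -> R) :
  Ex (fun x => g x + h x) = Ex g + Ex h.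
Proof. by rewrite /Ex big_split mulrDr. Qed.

Lemma ExZ (R : fieldType) n c (g : {ffun 'I_n -> bool} -> R) :
  Ex (fun x => c * g x) = c * Ex g.
Proof. by rewrite /Ex -mulr_sumr mulrCA. Qed.

Lemma Ex_sum (R : fieldType) n (I : finType) (P : pred I)
    (g : I -> {ffun 'I_n -> bool} -> R) :
  Ex (fun x => \sum_(i | P i) g i x) = \sum_(i | P i) Ex (g i).
Proof. by rewrite /Ex exchange_big mulr_sumr. Qed.

Lemma Ex_const (R : numFieldType) n (c : R) :
  Ex (fun _ : {ffun 'I_n -> bool} => c) = c.
Proof.
rewrite /Ex sumr_const card_ffun card_bool card_ord -[c *+ _]mulr_natl natrX mulrA.
by rewrite mulVf ?mul1r // expf_neq0 // pnatr_eq0.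
Qed.

Lemma ler_Ex (R : realFieldType) n (g h : {ffun 'I_n -> bool} -> R) :
  (forall x, g x <= h x) -> Ex g <= Ex h.
Proof.
move=> gh; rewrite /Ex ler_wpM2l ?invr_ge0 ?exprn_ge0 //.
exact: ler_sum.
Qed.

Lemma Ex_eq0 (R : realFieldType) n (g : {ffun 'I_n -> bool} -> R) :
  (forall x, 0 <= g x) -> Ex g <= 0 -> forall x, g x = 0.
Proof.
move=> g0 Eg x; apply/eqP; rewrite eq_le g0 andbT.
have : \sum_y g y <= 0.
  by move: Eg; rewrite /Ex pmulr_rle0 // invr_gt0 exprn_gt0.
by apply: le_trans; rewrite (bigD1 x) //= lerDl sumr_ge0.
Qed.

(* Minkowski's inequality in [L^k], with norms replaced by upper bounds so that
   no roots are needed. *)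
Lemma Ex_minkowski (R : realFieldType) n k (a b : R)
    (A B : {ffun 'I_n -> bool} -> R) :
  (0 < k)%N -> 0 <= a -> 0 <= b ->
  (forall x, 0 <= A x) -> (forall x, 0 <= B x) ->
  Ex (fun x => A x ^+ k) <= a ^+ k -> Ex (fun x => B x ^+ k) <= b ^+ k ->
  Ex (fun x => (A x + B x) ^+ k) <= (a + b) ^+ k.
Proof.
move=> k0 a0 b0 A0 B0 EA EB.
(* A zero bound forces the function to vanish; it is split off because the convexity argument
   divides by a and b. *)
have [ae|ane] := eqVneq a 0.
  move: EA; rewrite ae expr0n gtn_eqF // => EA.
  rewrite add0r; apply: le_trans EB; apply: ler_Ex => x.
  have /eqP := @Ex_eq0 _ _ (fun x => A x ^+ k) (fun y => exprn_ge0 k (A0 y)) EA x.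
  by rewrite expf_eq0 k0 /= => /eqP ->; rewrite add0r.
have [be|bne] := eqVneq b 0.
  move: EB; rewrite be expr0n gtn_eqF // => EB.
  rewrite addr0; apply: le_trans EA; apply: ler_Ex => x.
  have /eqP := @Ex_eq0 _ _ (fun x => B x ^+ k) (fun y => exprn_ge0 k (B0 y)) EB x.
  by rewrite expf_eq0 k0 /= => /eqP ->; rewrite addr0.
have ap : 0 < a by rewrite lt_def ane.
have bp : 0 < b by rewrite lt_def bne.
have cp : 0 < a + b by rewrite addr_gt0.
pose s := a / (a + b); pose t := b / (a + b).
have s0 : 0 <= s by rewrite divr_ge0 // ltW.
have t0 : 0 <= t by rewrite divr_ge0 // ltW.
have st : s + t = 1 by rewrite -mulrDl divff // gt_eqF.
(* Convexity bound for A/a and B/b with weights a/(a+b) and b/(a+b). *)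
pose c x := (a + b) ^+ k * (s / a ^+ k * A x ^+ k + t / b ^+ k * B x ^+ k).
apply: (@le_trans _ _ (Ex c)).
  apply: ler_Ex => x; rewrite /c.
  have -> : A x + B x = (a + b) * (s * (A x / a) + t * (B x / b)).
    by rewrite /s /t; field; rewrite ane bne gt_eqF.
  rewrite exprMn ler_wpM2l ?exprn_ge0 ?(ltW cp) //.
  have := @convex_expr _ _ _ (A x / a) (B x / b) k s0 t0 st.
  rewrite !expr_div_n !mulrA ![s * _ / _]mulrAC ![t * _ / _]mulrAC.
  by apply; rewrite divr_ge0.
rewrite /c ExZ -[leRHS]mulr1 ler_wpM2l ?exprn_ge0 ?(ltW cp) //.
rewrite ExD !ExZ -st lerD //.
  by rewrite mulrAC -mulrA ler_piMr // ler_pdivrMr ?exprn_gt0 // mul1r.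
by rewrite mulrAC -mulrA ler_piMr // ler_pdivrMr ?exprn_gt0 // mul1r.
Qed.

(** Pointwise, Z^k b^(m-k) <= b^m + Z^m, whether Z <= b or not. The factor 2 lost here spares
    Jensen's inequality with the fractional exponent m/k. *)
Lemma Ex_lower_moment (R : realFieldType) n k m (b : R)
    (Z : {ffun 'I_n -> bool} -> R) :
  (0 < k <= m)%N -> 0 <= b -> (forall x, 0 <= Z x) ->
  Ex (fun x => Z x ^+ m) <= b ^+ m -> Ex (fun x => Z x ^+ k) <= (2 * b) ^+ k.
Proof.
move=> /andP[k0 km] b0 Z0 EZ.
have [be|bne] := eqVneq b 0.
  have m0 : (0 < m)%N by exact: leq_trans km.
  move: EZ; rewrite be expr0n gtn_eqF // => EZ.
  rewrite mulr0 expr0n gtn_eqF // -[leRHS](@Ex_const _ n); apply: ler_Ex => x.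
  have /eqP := @Ex_eq0 _ _ (fun x => Z x ^+ m) (fun y => exprn_ge0 m (Z0 y)) EZ x.
  by rewrite expf_eq0 m0 /= => /eqP ->; rewrite expr0n gtn_eqF.
have bp : 0 < b by rewrite lt_def bne.
have bk : 0 < b ^+ (m - k) by rewrite exprn_gt0.
rewrite -(ler_pM2r bk) mulrC -ExZ.
apply: (@le_trans _ _ (Ex (fun x => b ^+ m + Z x ^+ m))).
  apply: ler_Ex => x; have Zx := Z0 x.
  case/orP: (le_total (Z x) b) => h.
    apply: ler_wpDr; first exact: exprn_ge0.
    by rewrite -[in leRHS](subnK km) exprD ler_pM2l // lerXn2r.
  apply: ler_wpDl; first exact: exprn_ge0.
  by rewrite -[in leRHS](subnK km) exprD ler_wpM2r ?exprn_ge0 // lerXn2r.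
rewrite ExD Ex_const exprMn -mulrA -exprD subnKC //.
apply: (@le_trans _ _ (2 * b ^+ m)); first by lra.
rewrite ler_wpM2r ?exprn_ge0 //.
by rewrite -[leLHS]expr1 ler_weXn2l // ler1n.
Qed.

(** * Coordinate flips and characters *)

Definition flip n (i : 'I_n) (x : {ffun 'I_n -> bool}) : {ffun 'I_n -> bool} :=
  [ffun j => (j == i) (+) x j].

Definition oflip n (o : option 'I_n) (x : {ffun 'I_n -> bool}) :=
  if o is Some i then flip i x else x.

Lemma flipK n (i : 'I_n) : involutive (flip i).
Proof. by move=> x; apply/ffunP => j; rewrite !ffunE addbA addbb. Qed.

Lemma flip_out n (i j : 'I_n) x : j != i -> flip i x j = x j.
Proof. by rewrite ffunE => /negbTE ->. Qed.

(** The coordinate may depend on x: as the flipped point selects the same one, the map is an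
    involution and preserves the uniform measure. *)
Lemma Ex_flip (R : fieldType) n (g : {ffun 'I_n -> bool} -> R)
    (o : {ffun 'I_n -> bool} -> option 'I_n) :
  (forall x i, o x = Some i -> o (flip i x) = Some i) ->
  Ex g = Ex (fun x => g (oflip (o x) x)).
Proof.
move=> ho; rewrite /Ex; congr (_ * _); apply: reindex_inj.
apply: inv_inj => x; case e: (o x) => [i|] /=; last by rewrite e.
by rewrite ho //= flipK.
Qed.

Lemma chi_flip_in (R : comNzRingType) n (S : {set 'I_n}) i x :
  i \in S -> chi R S (flip i x) = - chi R S x.
Proof.
move=> iS; rewrite /chi !(bigD1 i iS) /= -mulNr; congr (_ * _).
  by rewrite ffunE eqxx /pm; case: (x i); rewrite ?opprK.
by apply: eq_bigr => j /andP[_ ji]; rewrite flip_out.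
Qed.

Lemma chi_flip_out (R : nzRingType) n (S : {set 'I_n}) i x :
  i \notin S -> chi R S (flip i x) = chi R S x.
Proof.
move=> iS; apply: eq_bigr => j jS; rewrite flip_out //.
by apply: contraNneq iS => <-.
Qed.

Lemma chiU1 (R : comNzRingType) n (S : {set 'I_n}) i x :
  i \notin S -> chi R (i |: S) x = pm R (x i) * chi R S x.
Proof. by move=> iS; rewrite /chi big_setU1. Qed.

Lemma pm_sqr (R : nzRingType) b : pm R b ^+ 2 = 1.
Proof. by case: b; rewrite /pm ?sqrrN expr1n. Qed.

(** * Paths in a decision tree *)

Fixpoint residual n (T : dtree n) t (x : {ffun 'I_n -> bool}) : dtree n :=
  if t is t'.+1 then
    match residual T t' x with
    | Leaf b => Leaf n b
    | Node i t0 t1 => if x i then t0 else t1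
    end
  else T.

Fixpoint queried n (T : dtree n) t (x : {ffun 'I_n -> bool}) : {set 'I_n} :=
  if t is t'.+1 then
    match residual T t' x with
    | Leaf _ => queried T t' x
    | Node i _ _ => i |: queried T t' x
    end
  else set0.

(* Repeated queries are treated like no query. *)
Definition next_query n (T : dtree n) t x : option 'I_n :=
  match residual T t x with
  | Leaf _ => None
  | Node i _ _ => if i \in queried T t x then None else Some i
  end.

Lemma queriedS n (T : dtree n) t x :
  queried T t.+1 x =
    if next_query T t x is Some i then i |: queried T t x else queried T t x.
Proof.
rewrite /= /next_query; case: residual => // i _ _.
by case: ifP => // h; apply/setUidPr; rewrite sub1set.
Qed.

Lemma next_query_fresh n (T : dtree n) t x i :
  next_query T t x = Some i -> i \notin queried T t x.
Proof.
by rewrite /next_query; case: residual => // j _ _; case: ifP => // /negbT h [<-].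
Qed.

(** The walk reads its input only at the variables it queries. *)
Lemma queried_local n (T : dtree n) t (x y : {ffun 'I_n -> bool}) :
  {in queried T t x, x =1 y} ->
  residual T t y = residual T t x /\ queried T t y = queried T t x.
Proof.
elim: t => [//|t IH] /=; case e: (residual T t x) => [b|i t0 t1] h.
  by have [-> ->] := IH h; rewrite e.
have [|-> ->] := IH; first by move=> j jq; apply: h; rewrite setU1r.
by rewrite e -h ?setU11.
Qed.

Lemma queried_flip n (T : dtree n) t x i : i \notin queried T t x ->
  residual T t (flip i x) = residual T t x /\
  queried T t (flip i x) = queried T t x.
Proof.
move=> iq; apply: queried_local => j jq; rewrite flip_out //.
by apply: contraNneq iq => <-.
Qed.

Lemma next_query_flip n (T : dtree n) t x i :
  next_query T t x = Some i -> next_query T t (flip i x) = Some i.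
Proof.
move=> h; have [hr hq] := queried_flip (next_query_fresh h).
by rewrite -h /next_query hr hq.
Qed.

Lemma depth_residual n (T : dtree n) t x :
  (dt_depth (residual T t x) <= dt_depth T - t)%N.
Proof.
elim: t => [|t IH] /=; first by rewrite subn0.
case: residual IH => //= i t0 t1 h; rewrite subnS.
have : (maxn (dt_depth t0) (dt_depth t1) <= (dt_depth T - t).-1)%N.
  by rewrite -ltnS (ltn_predK h).
by rewrite geq_max => /andP[? ?]; case: ifP.
Qed.

Lemma eval_residual n (T : dtree n) t x : dt_eval (residual T t x) x = dt_eval T x.
Proof.
elim: t => //= t <-; case: residual => //= i t0 t1.
by case: (x i).
Qed.

(** After [dt_depth T] steps only a leaf remains, and the flip does not change which one. *)
Lemma dt_eval_flip n (T : dtree n) x i : i \notin queried T (dt_depth T) x ->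
  dt_eval T (flip i x) = dt_eval T x.
Proof.
move=> /queried_flip[hr _].
rewrite -(eval_residual T (dt_depth T)) hr -[RHS](eval_residual T (dt_depth T)).
have := depth_residual T (dt_depth T) x.
by rewrite subnn; case: residual.
Qed.

(** * The level martingale and its moments *)

Definition level_sum (R : nzRingType) n (T : dtree n) (a : {set 'I_n} -> R) l t x : R :=
  \sum_(S : {set 'I_n} | (S \subset queried T t x) && (#|S| == l)) a S * chi R S x.

(** The increment at level [l.+1], stripped of the fresh variable: hence level [l] and shifted
    coefficients. *)
Definition level_diff (R : nzRingType) n (T : dtree n) (a : {set 'I_n} -> R) l t x : R :=
  if next_query T t x is Some i
  then level_sum T (fun S => a (i |: S)) l t x else 0.

(** The default 1 keeps the square equal to 1; it is harmless since [level_diff] is then 0. *)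
Definition query_sign (R : nzRingType) n (T : dtree n) t x : R :=
  if next_query T t x is Some i then pm R (x i) else 1.

Lemma sum_subsetU1 (V : nmodType) n (A : {set 'I_n}) i l (F : {set 'I_n} -> V) :
  i \notin A ->
  \sum_(S : {set 'I_n} | (S \subset i |: A) && (#|S| == l.+1)) F S
  = \sum_(S : {set 'I_n} | (S \subset A) && (#|S| == l.+1)) F S
    + \sum_(S : {set 'I_n} | (S \subset A) && (#|S| == l)) F (i |: S).
Proof.
move=> iA; rewrite (bigID (fun S : {set 'I_n} => i \notin S)) /=; congr (_ + _).
  apply: eq_bigl => S; rewrite andbAC; congr (_ && _).
  apply/andP/idP => [[SA iS]|SA].
    apply/subsetP => j jS; move/subsetP: SA => /(_ j jS).
    by case/setU1P => // ji; rewrite -ji jS in iS.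
  split; first exact: subset_trans (subsetUr _ _).
  by apply: contra iA; apply: (subsetP SA).
(* The sets containing i are parametrised by what remains after removing i. *)
rewrite (reindex_onto (fun S => i |: S) (fun S => S :\ i)) /=; last first.
  by move=> S /andP[_]; rewrite negbK => iS; rewrite setD1K.
apply: eq_bigl => S; rewrite setU11 /= andbT.
case: (boolP (i \in S)) => iS.
  rewrite (_ : _ == S = false) ?andbF; last first.
    by apply/negP => /eqP h; move: iS; rewrite -h !inE eqxx.
  symmetry; apply/negbTE; rewrite negb_and; apply/orP; left.
  by apply: contra iA => /subsetP; apply.
rewrite setU1K // eqxx andbT cardsU1 iS add1n eqSS; congr (_ && _).
apply/idP/idP => h; last exact: setUS.
apply/subsetP => j jS; have := subsetP h j; rewrite !inE jS orbT => /(_ isT).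
by case/orP => // /eqP ji; rewrite -ji jS in iS.
Qed.

Lemma level_sumS (R : comNzRingType) n (T : dtree n) (a : {set 'I_n} -> R) l t x :
  level_sum T a l.+1 t.+1 x
  = level_sum T a l.+1 t x + query_sign R T t x * level_diff T a l t x.
Proof.
rewrite /level_sum /level_diff /query_sign queriedS.
case e: next_query => [i|]; last by rewrite mulr0 addr0.
have iq := next_query_fresh e.
rewrite sum_subsetU1 // mulr_sumr; congr (_ + _).
apply: eq_bigr => S /andP[Sq _]; rewrite chiU1 1?mulrCA //.
by apply: contra iq; apply: (subsetP Sq).
Qed.

Lemma level_sum_flip (R : nzRingType) n (T : dtree n) (a : {set 'I_n} -> R) l t x i :
  i \notin queried T t x -> level_sum T a l t (flip i x) = level_sum T a l t x.
Proof.
move=> iq; rewrite /level_sum (queried_flip iq).2.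
apply: eq_bigr => S /andP[Sq _]; rewrite chi_flip_out //.
by apply: contra iq; apply: (subsetP Sq).
Qed.

(** Flipping the fresh variable reverses only the increment, so a point and its flip carry the
    values a + b and a - b of the two-point inequality. *)
Lemma level_sumS_flip (R : comNzRingType) n (T : dtree n) (a : {set 'I_n} -> R) l t x :
  level_sum T a l.+1 t.+1 (oflip (next_query T t x) x)
  = level_sum T a l.+1 t x - query_sign R T t x * level_diff T a l t x.
Proof.
rewrite level_sumS /level_diff /query_sign.
case e: (next_query T t x) => [i|] /=; last by rewrite e !mulr0 addr0 subr0.
have iq := next_query_fresh e.
rewrite (next_query_flip e) !level_sum_flip //; congr (_ + _).
rewrite -mulNr; congr (_ * _).
by rewrite ffunE eqxx /pm; case: (x i); rewrite ?opprK.
Qed.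

Lemma Ex_level_sumS (R : realFieldType) n (T : dtree n) (a : {set 'I_n} -> R) l t k :
  Ex (fun x => level_sum T a l.+1 t.+1 x ^+ (2 * k))
  <= Ex (fun x => (level_sum T a l.+1 t x ^+ 2
                   + 4 * k%:R * level_diff T a l t x ^+ 2) ^+ k).
Proof.
pose g x := level_sum T a l.+1 t.+1 x ^+ (2 * k).
have hf := Ex_flip g (@next_query_flip _ T t).
suff : Ex g + Ex g <= 2 * Ex (fun x => (level_sum T a l.+1 t x ^+ 2
                   + 4 * k%:R * level_diff T a l t x ^+ 2) ^+ k).
  by rewrite /g; lra.
rewrite {2}hf -ExD -ExZ; apply: ler_Ex => x.
rewrite /g level_sumS level_sumS_flip.
apply: le_trans (two_point_moment _ _ _) _.
rewrite exprMn (_ : query_sign R T t x ^+ 2 = 1) ?mul1r //.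
by rewrite /query_sign; case: next_query => [i|]; rewrite ?pm_sqr ?expr1n.
Qed.

(** Summing over all possible queries i gives an m-th moment of at most n D^m <= (2D)^m; passing
    from m down to k costs the other factor 2. *)
Lemma Ex_level_diff (R : realFieldType) n (T : dtree n) (a : {set 'I_n} -> R)
    l t k m (D : R) :
  (0 < k <= m)%N -> n%:R <= 2 ^+ m :> R -> 0 <= D ->
  (forall i, Ex (fun x => level_sum T (fun S => a (i |: S)) l t x ^+ (2 * m))
             <= D ^+ m) ->
  Ex (fun x => (level_diff T a l t x ^+ 2) ^+ k) <= (4 * D) ^+ k.
Proof.
move=> km nm D0 hD; have -> : 4 * D = 2 * (2 * D) by ring.
apply: (@Ex_lower_moment _ _ _ _ _ (fun x => level_diff T a l t x ^+ 2) km);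
  [exact: mulr_ge0 | by move=> x; apply: sqr_ge0 |].
pose g i x := level_sum T (fun S => a (i |: S)) l t x ^+ (2 * m).
have g0 i x : 0 <= g i x by rewrite /g exprM; apply: exprn_ge0; apply: sqr_ge0.
apply: (@le_trans _ _ (Ex (fun x => \sum_i g i x))).
  apply: ler_Ex => x; rewrite -exprM /level_diff.
  case: next_query => [i|].
    by rewrite (bigD1 i) //= lerDl sumr_ge0.
  rewrite expr0n muln_eq0 /= gtn_eqF ?sumr_ge0 //.
  by case/andP: km => k0; apply: leq_trans.
rewrite Ex_sum exprMn.
apply: (@le_trans _ _ (\sum_(i < n) D ^+ m)); first by apply: ler_sum => i _; apply: hD.
by rewrite sumr_const card_ord -[leLHS]mulr_natl ler_wpM2r // exprn_ge0.
Qed.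

(** Induction on l, then on t. The offset j is general because the increments are controlled through
    the larger moment [K j.+1], and [a] is general because each query shifts the coefficients. *)
Lemma Ex_level_sum (R : realFieldType) n (T : dtree n) (K : nat -> nat) :
  (forall i, (0 < K i)%N) -> (forall i, (K i <= K i.+1)%N) ->
  (forall i, n%:R <= 2 ^+ K i.+1 :> R) ->
  forall l j t (a : {set 'I_n} -> R), (forall S, `|a S| <= 1) ->
  Ex (fun x => level_sum T a l t x ^+ (2 * K j))
  <= (16 ^+ l * (\prod_(i < l) (K (j + i)%N)%:R) * 'C(t, l)%:R) ^+ K j.
Proof.
move=> K0 Kmono nK; elim=> [|l IHl] j t a ha.
  rewrite big_ord0 expr0 bin0 !mul1r expr1n -[leRHS](@Ex_const _ n).
  apply: ler_Ex => x; rewrite /level_sum (big_pred1 set0) /=; last first.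
    by move=> S; rewrite cards_eq0 andb_idl // => /eqP ->; apply: sub0set.
  rewrite /chi big_set0 mulr1 exprM; apply: exprn_ile1; first exact: sqr_ge0.
  by have := ha set0; rewrite ler_norml => /andP[]; nra.
elim: t => [|t IHt].
  rewrite bin0n mulr0 expr0n gtn_eqF //= -[leRHS](@Ex_const _ n).
  apply: ler_Ex => x; rewrite /level_sum big_pred0 ?expr0n ?muln_eq0 ?gtn_eqF //.
  by move=> S /=; rewrite subset0; case: eqP => // ->; rewrite cards0.
apply: le_trans (Ex_level_sumS _ _ _ _ _) _.
set P := 16 ^+ l.+1 * _ in IHt *.
pose Q : R := 16 ^+ l * (\prod_(i < l) (K (j.+1 + i)%N)%:R) * 'C(t, l)%:R.
have Q0 : 0 <= Q by rewrite !mulr_ge0 ?exprn_ge0 ?prodr_ge0.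
have P0 : 0 <= P by rewrite mulr_ge0 ?exprn_ge0 ?prodr_ge0.
(* Pascal's rule matches the martingale step; 16 is the 4 of the two-point inequality times the 4 of
   [Ex_level_diff]. *)
have eP : P * 'C(t.+1, l.+1)%:R = P * 'C(t, l.+1)%:R + 4 * (K j)%:R * (4 * Q).
  rewrite binS natrD mulrDr; congr (_ + _).
  rewrite /P /Q big_ord_recl addn0 exprS.
  under eq_bigr => i _ do rewrite addnS -addSn.
  ring.
rewrite eP; apply: Ex_minkowski => //.
- by rewrite mulr_ge0.
- by apply: mulr_ge0; apply: mulr_ge0.
- by move=> x; apply: sqr_ge0.
- by move=> x; apply: mulr_ge0; [exact: mulr_ge0 | exact: sqr_ge0].
- by under eq_Ex => x do rewrite -exprM.
under eq_Ex => x do rewrite exprMn.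
rewrite ExZ [leRHS]exprMn ler_wpM2l ?exprn_ge0 ?mulr_ge0 //.
by apply: (@Ex_level_diff _ _ _ _ _ _ _ (K j.+1)); rewrite ?K0 //= => i; apply: IHl.
Qed.

(** * Fourier sums of a tree as correlations *)

(** Flipping an unqueried element of S preserves the path and the value of the tree but negates the
    character, so the expectation equals its own opposite. *)
Lemma Ex_eval_chi_unqueried (R : realFieldType) n (T : dtree n) (S : {set 'I_n}) :
  Ex (fun x => fval R (dt_eval T) x *
               if S \subset queried T (dt_depth T) x then 0 else chi R S x) = 0.
Proof.
set g := fun x => _.
pose o x := [pick i in S :\: queried T (dt_depth T) x].
have fresh x i : o x = Some i -> i \in S /\ i \notin queried T (dt_depth T) x.
  by rewrite /o; case: pickP => // j /setDP[jS jq] [<-].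
have ho x i : o x = Some i -> o (flip i x) = Some i.
  by move=> e; rewrite -e /o (queried_flip (fresh _ _ e).2).2.
suff : Ex g = - Ex g by lra.
rewrite {1}(Ex_flip g ho) -mulN1r -ExZ; apply: eq_Ex => x.
case e: (o x) => [i|] /=.
  have [iS iq] := fresh _ _ e.
  rewrite /g /fval dt_eval_flip // (queried_flip iq).2 chi_flip_in //.
  by case: ifP => _; ring.
rewrite /g (_ : S \subset _) ?mulr0 //.
apply/subsetP => i iS; apply/negPn/negP => iq.
by move: e; rewrite /o; case: pickP => // /(_ i); rewrite inE iS iq.
Qed.

Lemma sum_norm_fourier (R : realFieldType) n (T : dtree n) l :
  \sum_(S : {set 'I_n} | #|S| == l) `|fourier R (dt_eval T) S|
  = Ex (fun x => fval R (dt_eval T) x *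
      level_sum T (fun S => Num.sg (fourier R (dt_eval T) S)) l (dt_depth T) x).
Proof.
pose g (S : {set 'I_n}) x := fval R (dt_eval T) x *
  if S \subset queried T (dt_depth T) x then chi R S x else 0.
have hS S : fourier R (dt_eval T) S = Ex (g S).
  rewrite -[RHS]addr0 -(Ex_eval_chi_unqueried R T S) -ExD; apply: eq_Ex => x.
  by rewrite /g; case: ifP => _; rewrite mulr0 ?addr0 ?add0r.
transitivity (\sum_(S : {set 'I_n} | #|S| == l)
    Ex (fun x => Num.sg (fourier R (dt_eval T) S) * g S x)).
  by apply: eq_bigr => S _; rewrite ExZ -hS normrEsg.
rewrite -Ex_sum; apply: eq_Ex => x.
rewrite /level_sum mulr_sumr.
under [RHS]eq_bigl do rewrite andbC.
rewrite big_mkcondr /=; apply: eq_bigr => S _; rewrite /g.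
by case: ifP => _; rewrite ?mulr0 // mulrCA.
Qed.

(** * Correlation with an indicator of small mean *)

Lemma prob1_ge0 (R : realFieldType) n (f : {ffun 'I_n -> bool} -> bool) :
  0 <= prob1 R f.
Proof. by rewrite mulr_ge0 ?invr_ge0 ?exprn_ge0 // sumr_ge0 // => x _; apply: ler0n. Qed.

Lemma prob1_le1 (R : realFieldType) n (f : {ffun 'I_n -> bool} -> bool) :
  prob1 R f <= 1.
Proof.
rewrite -[leRHS](@Ex_const _ n); apply: (@ler_Ex _ _ (fval R f)) => x.
by rewrite /fval lern1; case: (f x).
Qed.

(** A root-free substitute for Hölder: pointwise f X <= 2s f + 2s (X/2s)^(2k), by comparing X/2s
    with 1. The last term has mean at most 2s/4^k <= 2s p. *)
Lemma Ex_mul_indicator_le (R : realFieldType) n (f : {ffun 'I_n -> bool} -> bool)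
    (X : {ffun 'I_n -> bool} -> R) (s : R) k :
  (0 < k)%N -> 0 < s -> 1 <= prob1 R f * 2 ^+ k ->
  Ex (fun x => X x ^+ (2 * k)) <= s ^+ (2 * k) ->
  Ex (fun x => fval R f x * X x) <= 4 * s * prob1 R f.
Proof.
move=> k0 s0 pk EX; set p := prob1 R f in pk *.
have s20 : 0 < 2 * s by rewrite mulr_gt0.
pose c := 2 * s / (2 * s) ^+ (2 * k).
apply: (@le_trans _ _
  (Ex (fun x => 2 * s * fval R f x + c * X x ^+ (2 * k)))).
  apply: ler_Ex => x.
  have -> : c * X x ^+ (2 * k) = 2 * s * (X x / (2 * s)) ^+ (2 * k).
    by rewrite /c expr_div_n; ring.
  rewrite -[X in _ * X <= _](@divfK _ (2 * s)) ?gt_eqF //.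
  set u := X x / (2 * s).
  have u0 : 0 <= u ^+ (2 * k) by rewrite exprM; apply: exprn_ge0; apply: sqr_ge0.
  rewrite [fval R f x * _]mulrA [_ * (2 * s)]mulrC -mulrDr ler_pM2l //.
  rewrite /fval; case: (f x); rewrite ?mul0r ?add0r // mul1r.
  case/orP: (le_total u 1) => u1; first by rewrite ler_wpDr.
  by rewrite ler_wpDl // -[leLHS]expr1 ler_weXn2l // muln_gt0.
rewrite ExD !ExZ -[Ex (fval R f)]/p.
have e2 : (2 * s) ^+ (2 * k) = 2 ^+ k * 2 ^+ k * s ^+ (2 * k).
  by rewrite exprMn -exprD addnn mul2n.
have h1 : c * Ex (fun x => X x ^+ (2 * k)) <= 2 * s / (2 ^+ k * 2 ^+ k).
  apply: le_trans (ler_wpM2l _ EX) _; first by rewrite divr_ge0 ?exprn_ge0 ?ltW.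
  rewrite /c e2 le_eqVlt; apply/orP; left; apply/eqP; field.
  by rewrite !expf_neq0 ?gt_eqF.
have k2 : 0 < 2 ^+ k :> R by rewrite exprn_gt0.
have h2 : 2 * s / (2 ^+ k * 2 ^+ k) <= 2 * s * p.
  rewrite ler_pM2l // -[leLHS]mul1r ler_pdivrMr ?mulr_gt0 // mulrA.
  apply: (le_trans pk); apply: ler_peMr; last by rewrite exprn_ege1 // ler1n.
  by apply: mulr_ge0; [exact: prob1_ge0 | exact: ltW].
lra.
Qed.

(** * Choice of the exponents and conclusion *)

Lemma exists_le_exp2 (R : archiRealFieldType) (M : R) : exists k, M <= 2 ^+ k.
Proof.
exists (Num.bound `|M|); apply: le_trans (ler_norm M) _.
apply: le_trans (ltW (archi_boundP (normr_ge0 _))) _.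
by rewrite -natrX ler_nat ltnW // ltn_expl.
Qed.

(** Minimality gives 2^(k-1) < M; the lost unit costs ln 2 <= ln M, whence the factor 2. *)
Lemma least_exp2_ln_le (R : realType) (M : R) (k : nat) : 4 <= M ->
  (forall m, M <= 2 ^+ m -> (k <= m)%N) -> k%:R * ln 2 <= 2 * ln M.
Proof.
move=> M4 kmin.
have M0 : 0 < M by apply: lt_le_trans M4.
have l2 : ln 2 <= ln M.
  by rewrite ler_ln ?posrE //; apply: le_trans M4; rewrite ler_nat.
case: k kmin => [|k] kmin; first by rewrite mul0r mulr_ge0 // ln_ge0 //; lra.
have k2 : 2 ^+ k < M by rewrite ltNge; apply/negP => /kmin; rewrite ltnn.
have : ln (2 ^+ k) <= ln M by rewrite ler_ln ?posrE ?exprn_gt0 // ltW.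
by rewrite lnXn // -[ln 2 *+ k]mulr_natl -natr1; lra.
Qed.

Lemma prod_sqrtr (R : rcfType) (I : finType) (F : I -> R) :
  (forall i, 0 <= F i) ->
  \prod_i Num.sqrt (F i) = Num.sqrt (\prod_i F i).
Proof.
move=> F0; elim/big_rec2: _ => [|i y z _ ->]; first by rewrite sqrtr1.
by rewrite sqrtrM.
Qed.

Theorem mainTheorem7 (R : realType) :
  exists c : R,
    forall (n d : nat) (T : dtree n) (f : {ffun 'I_n -> bool} -> bool),
      dt_depth T = d ->
      (forall x, f x = dt_eval T x) ->
      forall l : nat, (l <= d)%N ->
        \sum_(S : {set 'I_n} | #|S| == l) `|fourier R f S|
        <= Num.sqrt (c ^+ l * ('C(d, l))%:R) * prob1 R f
           * \prod_(i < l) Num.sqrt (ln (4 * (n%:R) ^+ i / prob1 R f)).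
Proof.
have ln2 : 0 < ln 2 :> R by rewrite ln_gt0 // ltr1n.
(* 512 = 16 * 16 * 2: the moment bound, the square of the 4 in [Ex_mul_indicator_le], and the 2 of
   [least_exp2_ln_le]. *)
pose c : R := 512 / ln 2; have c0 : 0 < c by rewrite divr_gt0.
exists c => n d T f dT /boolp.funext fT l ld; rewrite {f}fT.
set p := prob1 R (dt_eval T).
(* Level 0 is separate: there c^0 = 1 leaves no room for the factor 4. *)
case: l ld => [_|l ld].
  rewrite (big_pred1 set0) => [|S]; last by rewrite /= cards_eq0.
  rewrite big_ord0 expr0 bin0 !mul1r sqrtr1 mul1r mulr1.
  rewrite (_ : fourier R (dt_eval T) set0 = p) ?ger0_norm ?prob1_ge0 //.
  by apply: eq_Ex => x; rewrite big_set0 mulr1.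
(* For p = 0 the function vanishes and the factor p kills the right-hand side, whatever the
   quotients by p denote. *)
have [p0|pn0] := eqVneq p 0.
  have f0 : forall x, fval R (dt_eval T) x = 0.
    by apply: Ex_eq0 => [x|]; rewrite ?ler0n // -[Ex _]/p p0.
  rewrite p0 mulr0 mul0r sum_norm_fourier -[leRHS](@Ex_const _ n).
  by apply: ler_Ex => x; rewrite f0 mul0r.
have pp : 0 < p by rewrite lt_def pn0 prob1_ge0.
have p1 : p <= 1 by exact: prob1_le1.
have n0 : (0 < n)%N.
  (* A tree of positive depth queries a variable, so there is one. *)
  by move: ld; rewrite -dT; case: (T) => // -[m mn] _ _ _; apply: leq_ltn_trans mn.
pose M i : R := 4 * n%:R ^+ i / p.
have M4 i : 4 <= M i.
  by rewrite /M ler_pdivlMr // ler_pM2l // (le_trans p1) // exprn_ege1 // ler1n.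
have MS i : M i <= M i.+1.
  by rewrite /M ler_pM2r ?invr_gt0 // ler_pM2l // ler_weXn2l ?ler1n.
(* The least exponent with 4 n^i / p <= 2^(K i): large enough for the moment bounds, yet logarithmic
   in 4 n^i / p. *)
pose K i := ex_minn (exists_le_exp2 (M i)).
have MK i : M i <= 2 ^+ K i by rewrite /K; case: ex_minnP.
have Kmin i m : M i <= 2 ^+ m -> (K i <= m)%N by rewrite /K; case: ex_minnP => ? _; apply.
clearbody K.
have K0 i : (0 < K i)%N.
  rewrite lt0n; apply/eqP => e; have := MK i; rewrite e expr0.
  by have := M4 i; lra.
have KS i : (K i <= K i.+1)%N by apply: Kmin; apply: le_trans (MK _).
have nK i : n%:R <= 2 ^+ K i.+1 :> R.
  apply: le_trans (MK _); rewrite /M ler_pdivlMr // exprS.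
  have h1 : 1 <= n%:R ^+ i :> R by rewrite exprn_ege1 // ler1n.
  have h2 : 1 <= n%:R :> R by rewrite ler1n.
  nra.
pose a S := Num.sg (fourier R (dt_eval T) S).
have ha S : `|a S| <= 1 by rewrite normr_sg lern1; case: eqP.
pose D : R := 16 ^+ l.+1 * (\prod_(i < l.+1) (K i)%:R) * 'C(d, l.+1)%:R.
have D0 : 0 < D.
  rewrite !mulr_gt0 ?exprn_gt0 ?ltr0n ?bin_gt0 //.
  by apply: prodr_gt0 => i _; rewrite ltr0n.
have EX := Ex_level_sum T K0 KS nK l.+1 0 d ha.
rewrite sum_norm_fourier dT.
apply: (@le_trans _ _ (4 * Num.sqrt D * p)).
  apply: (@Ex_mul_indicator_le _ _ _ _ _ (K 0)) => //; first by rewrite sqrtr_gt0.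
    have := MK 0; rewrite /M expr0 mulr1 ler_pdivrMr // -/p mulrC; lra.
  by rewrite [leRHS]exprM (sqr_sqrtr (ltW D0)).
rewrite [leRHS]mulrAC ler_pM2r //.
have M1 i : 1 <= M i by apply: le_trans (M4 i); rewrite ler1n.
rewrite prod_sqrtr => [|i]; last exact/ln_ge0/M1.
have s16 : 4 = Num.sqrt (16 : R).
  by rewrite (_ : 16 = 4 ^+ 2) ?sqrtr_sqr ?ger0_norm //; ring.
have cC0 : 0 <= c ^+ l.+1 * 'C(d, l.+1)%:R by rewrite mulr_ge0 // exprn_ge0 // ltW.
rewrite [X in X * _ <= _]s16 -!sqrtrM // ler_wsqrtr //.
have hK : \prod_(i < l.+1) (K i)%:R <= (2 / ln 2) ^+ l.+1 * \prod_(i < l.+1) ln (M i).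
  have -> : (2 / ln 2) ^+ l.+1 = \prod_(i < l.+1) (2 / ln 2) :> R.
    by rewrite prodr_const card_ord.
  rewrite -big_split /=; apply: ler_prod => i _.
  rewrite ler0n /= mulrAC ler_pdivlMr //.
  by apply: least_exp2_ln_le => // m; apply: Kmin.
(* The single 16 under the root is absorbed into a second power 16^(l+1). *)
have h16 : 16 <= 16 ^+ l.+1 :> R by rewrite -[leLHS]expr1 ler_weXn2l // ler1n.
have -> : c ^+ l.+1 = 16 ^+ l.+1 * 16 ^+ l.+1 * (2 / ln 2) ^+ l.+1.
  by rewrite -!exprMn /c; congr (_ ^+ _); field; rewrite gt_eqF.
rewrite /D -!mulrA; apply: ler_pM => //.
  by rewrite !mulr_ge0 ?exprn_ge0 ?prodr_ge0.
by rewrite ler_pM2l ?exprn_gt0 // [leLHS]mulrC [leRHS]mulrCA ler_wpM2l.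
Qed.
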